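(* Let $X_1,X_2,\dots$ be dependent random variables, all with the same distribution as a random variable $X$, and let $N$ be a random variable with values in $\{0,1,2,\dots\}$ which is independent of all the $X_i$, $i=1,2,\dots$. Let $S_N=X_1+\dots+X_N$. Then the mean and the variance of $S_N$ are given by $$E(S_N)=E(N)E(X),$$ $$\mathrm{var}(S_N)=E(N)\,\mathrm{var}(X)+\mathrm{var}(N)\,(E(X))^2+E[N(N-1)]\,\mathrm{cov}(X_i,X_j),$$ where $\mathrm{cov}(X_i,X_j)$ denotes the covariance between two different claims $X_i$ and $X_j$, $i\neq j$.
   Context: This is the collective risk model under dependence: $N$ is the number of claims in a portfolio of policies in a time period, $X_i$ is the amount of the $i$th claim, and $S_N$ is the aggregate claims of the portfolio in that period (with $S_N=0$ if $N=0$). *)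

(* Defs.v *)
From mathcomp Require Import all_boot all_order all_algebra.
From mathcomp Require Import all_classical all_reals all_analysis.

Set Implicit Arguments.
Unset Strict Implicit.
Unset Printing Implicit Defensive.

Import Order.TTheory GRing.Theory Num.Theory.

Local Open Scope classical_set_scope.
Local Open Scope ring_scope.

Section collective_risk.
Context {d : measure_display} {T : measurableType d} {R : realType}.
Variable P : probability T R.

(* Only Borel sets matter: a set function also has values on non-measurable
   sets, so this is weaker than equality of the two set functions. *)
Definition identically_distributed (Y Z : {RV P >-> R}) : Prop :=
  forall B : set R, measurable B -> distribution P Y B = distribution P Z B.

Definition sigma_of_seq (X : nat -> {RV P >-> R}) : set (set T) :=
  <<s \bigcup_i preimage_set_system setT (X i) measurable >>.

(* [N] is independent of the sequence as a whole, not merely of each of its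
   terms separately. *)
Definition independent_of_seq (N : {RV P >-> nat}) (X : nat -> {RV P >-> R})
    : Prop :=
  forall (A : set nat) (E : set T), measurable A -> sigma_of_seq X E ->
  P (N @^-1` A `&` E) = (P (N @^-1` A) * P E)%E.

Definition claim_count (N : {RV P >-> nat}) : T -> R := fun w => (N w)%:R.

(* Claims are numbered from 0: [X i] is the claim usually written X_(i+1). *)
Definition aggregate_claims (N : {RV P >-> nat}) (X : nat -> {RV P >-> R})
    : T -> R :=
  fun w => \sum_(i < N w) X i w.

End collective_risk.

(* Main.v *)
(* Condition on N.  Write S_n = X_1 + ... + X_n.  Since N is independent of S_n,
   integrating g(S_N) over the events [N = n] gives E[g(S_N)] = E[h(N)] with
   h(n) = E[g(S_n)], first for g >= 0 and then for g = id through the positive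
   and negative parts.  Bilinearity of the covariance gives E[S_n] = n m and
   var(S_n) = n v + n (n - 1) c, whence
   E[S_n^2] = n (v - c) + n^2 (c + m^2); averaging over N yields E[S_N] and
   E[S_N^2], and var(S_N) is their combination E[S_N^2] - E[S_N]^2. *)
Require Import Defs.
From mathcomp Require Import all_boot all_order all_algebra.
From mathcomp Require Import all_classical all_reals all_analysis.
From mathcomp Require Import measurable_realfun ring.

Set Implicit Arguments.
Unset Strict Implicit.
Unset Printing Implicit Defensive.

Import Order.TTheory GRing.Theory Num.Theory.
Local Open Scope classical_set_scope.
Local Open Scope ring_scope.
Local Open Scope ereal_scope.

(** * Integrals and expectations at an independent random index *)

(** Split the space into [A] and its complement: the restricted measure agrees with [mu] on subsets
    of [A] and vanishes on subsets of the complement. *)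
Lemma ge0_integral_mrestr (d : measure_display) (T : measurableType d)
    (R : realType) (mu : {measure set T -> \bar R}) (A : set T)
    (mA : measurable A) (f : T -> \bar R) :
  measurable_fun [set: T] f -> (forall x, 0 <= f x) ->
  \int[mrestr mu mA]_x f x = \int[mu]_(x in A) f x.
Proof.
move=> mf f0; rewrite -(setUv A) ge0_integral_setU//.
- rewrite (eq_measure_integral mu) => [|B mB BA]; last first.
    by rewrite /= /mrestr setIidl.
  rewrite [X in _ + X](eq_measure_integral mzero) => [|B mB BA]; last first.
    by rewrite /= /mrestr (disjoints_subset _ _).2// measure0.
  by rewrite integral_measure_zero adde0.
- exact: measurableC.
- by rewrite setUv.
- by apply/disj_setPCl.
Qed.

Lemma ge0_integral_indep (d : measure_display) (T : measurableType d)
    (R : realType) (P : probability T R) (A : set T) (Y : T -> R)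
    (g : R -> \bar R) :
  measurable A -> measurable_fun [set: T] Y ->
  (forall B : set R, measurable B ->
    P (A `&` Y @^-1` B) = P A * P (Y @^-1` B)) ->
  measurable_fun [set: R] g -> (forall y, 0 <= g y) ->
  \int[P]_(w in A) g (Y w) = P A * \int[P]_w g (Y w).
Proof.
move=> mA mY AY mg g0.
(* The law of [Y] on [A] is [P A] times the law of [Y]. *)
have PA0 : (0 <= fine (P A))%R by rewrite fine_ge0.
have PAE : (NngNum PA0)%:num%:E = P A by rewrite /= fineK ?fin_num_measure.
have mgY : measurable_fun [set: T] (fun w => g (Y w)).
  exact: measurableT_comp.
have transfer (mu : {measure set T -> \bar R}) :
    \int[mu]_w g (Y w) = \int[pushforward mu Y]_y g y.
  by rewrite (ge0_integral_pushforward mY mu).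
rewrite -(ge0_integral_mrestr P mA)//.
rewrite -PAE -ge0_integral_mscale// !transfer.
apply: eq_measure_integral => B mB _.
by rewrite /= /mscale PAE [LHS]/mrestr /pushforward setIC; exact: AY.
Qed.

(** The events [[N = n]] form a countable measurable cover, and on each of them the function
    coincides with [Y n]. *)
Lemma measurable_random_index (d : measure_display) (T : measurableType d)
    (R : realType) (P : probability T R) (N : {RV P >-> nat})
    (Y : nat -> T -> R) :
  (forall n, measurable_fun [set: T] (Y n)) ->
  measurable_fun [set: T] (fun w => Y (N w) w).
Proof.
move=> mY.
have NT : [set: T] = \bigcup_n (N @^-1` [set n]).
  by apply/seteqP; split => // w _; exists (N w).
rewrite NT measurable_fun_bigcup => n; last exact: measurable_funPTI.
apply: (@eq_measurable_fun _ _ _ _ _ (Y n)) => [w|].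
  by rewrite inE => /= ->.
exact: measurable_funTS.
Qed.

Lemma ge0_integral_random_index (d : measure_display) (T : measurableType d)
    (R : realType) (P : probability T R) (N : {RV P >-> nat})
    (Y : nat -> T -> R) (g : R -> \bar R) :
  (forall n, measurable_fun [set: T] (Y n)) ->
  (forall n (B : set R), measurable B ->
    P (N @^-1` [set n] `&` Y n @^-1` B) =
    P (N @^-1` [set n]) * P (Y n @^-1` B)) ->
  measurable_fun [set: R] g -> (forall y, 0 <= g y) ->
  \int[P]_w g (Y (N w) w) = \int[P]_w \int[P]_v g (Y (N w) v).
Proof.
move=> mY NY mg g0.
have NT : [set: T] = \bigcup_n (N @^-1` [set n]).
  by apply/seteqP; split => // w _; exists (N w).
have mN n : measurable (N @^-1` [set n]) by exact: measurable_funPTI.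
have tN : trivIset setT (fun n => N @^-1` [set n]).
  exact: trivIset_preimage1.
(* Split over the events [N = n], which are independent of [Y n]. *)
transitivity (\sum_(n <oo) \int[P]_(w in N @^-1` [set n]) g (Y (N w) w)).
  rewrite {1}NT ge0_integral_bigcup// -NT.
  apply: measurableT_comp => //; exact: measurable_random_index.
transitivity (\sum_(n <oo)
    \int[P]_(w in N @^-1` [set n]) \int[P]_v g (Y (N w) v)); last first.
  rewrite {2}NT ge0_integral_bigcup// -?NT.
    by apply: (measurableT_comp (f := fun n => \int[P]_v g (Y n v))).
  by move=> w _; exact: integral_ge0.
apply: eq_eseriesr => n _.
transitivity (\int[P]_(w in N @^-1` [set n]) g (Y n w)).
  by apply: eq_integral => w; rewrite inE => /= ->.
rewrite ge0_integral_indep//; last exact: NY.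
(* On [[N = n]] the inner integral no longer depends on [w], so integrating it only multiplies it by
   the probability of this event. *)
rewrite [RHS](eq_integral (cst (\int[P]_v g (Y n v)))) => [|w]; last first.
  by rewrite inE => /= ->.
by rewrite integral_cst// muleC.
Qed.

(** The finiteness hypothesis concerns the average over [N], where it can be checked from moments at
    fixed [n]. The nonnegative case applied to the absolute value turns it into integrability of
    [Y (N w) w], so both parts have finite integrals and may be subtracted. *)
Lemma expectation_random_index (d : measure_display) (T : measurableType d)
    (R : realType) (P : probability T R) (N : {RV P >-> nat})
    (Y : nat -> T -> R) :
  (forall n, measurable_fun [set: T] (Y n)) ->
  (forall n (B : set R), measurable B ->
    P (N @^-1` [set n] `&` Y n @^-1` B) =
    P (N @^-1` [set n]) * P (Y n @^-1` B)) ->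
  \int[P]_w 'E_P[fun v => `|Y (N w) v|%R] < +oo ->
  'E_P[fun w => Y (N w) w] = \int[P]_w 'E_P[Y (N w)].
Proof.
move=> mY NY Yoo.
pose f w := (Y (N w) w)%:E.
have mf : measurable_fun [set: T] f.
  exact/measurable_EFinP/measurable_random_index.
have intf : P.-integrable [set: T] f.
  apply/integrableP; split => //; move: Yoo; rewrite unlock.
  rewrite -(@ge0_integral_random_index _ _ _ _ _ _ (fun y => `|y|%:E))//.
  by apply/measurable_EFinP; exact: normr_measurable.
(* Positive and negative parts as functions of the value [y], so that the nonnegative case applies
   to each of them. *)
pose gp (y : R) := maxe y%:E 0; pose gn (y : R) := maxe (- y%:E) 0.
have mgp : measurable_fun [set: R] gp.
  by apply: measurable_maxe.
have mgn : measurable_fun [set: R] gn.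
  apply: measurable_maxe => //; exact: measurableT_comp.
have gp0 y : 0 <= gp y by rewrite le_max lexx orbT.
have gn0 y : 0 <= gn y by rewrite le_max lexx orbT.
(* Integrability of the averaged parts, which allows the difference of the two integrals over [N] to
   be merged into one. *)
have intg g : measurable_fun [set: R] g -> (forall y, 0 <= g y) ->
    \int[P]_w g (Y (N w) w) < +oo ->
    P.-integrable [set: T] (fun w => \int[P]_v g (Y (N w) v)).
  move=> mg g0 goo; apply/integrableP; split.
    by apply: (measurableT_comp (f := fun n => \int[P]_v g (Y n v))).
  under eq_integral => w _ do rewrite gee0_abs ?integral_ge0//.
  by rewrite -(ge0_integral_random_index mY NY mg g0).
have fp : \int[P]_w f^\+ w = \int[P]_w gp (Y (N w) w).
  by apply: eq_integral => w _; rewrite funeposE.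
have fn : \int[P]_w f^\- w = \int[P]_w gn (Y (N w) w).
  by apply: eq_integral => w _; rewrite funenegE.
rewrite unlock -/f integralE fp fn.
rewrite !ge0_integral_random_index// -integralB//; last 2 first.
- by apply: intg => //; rewrite -fp integrable_lty//; exact: integrable_funepos.
- by apply: intg => //; rewrite -fn integrable_lty//; exact: integrable_funeneg.
apply: eq_integral => w _; rewrite [RHS]integralE; congr (_ - _).
  by apply: eq_integral => v _; rewrite funeposE.
by apply: eq_integral => v _; rewrite funenegE.
Qed.

(** * Sums of a fixed number of claims: independence from [N] and moments *)

Lemma independent_of_seq_preimage (d : measure_display) (T : measurableType d)
    (R : realType) (P : probability T R) (Xs : nat -> {RV P >-> R})
    (N : {RV P >-> nat}) (f : nat -> T -> R) :
  independent_of_seq N Xs ->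
  (forall n, @measurable_fun _ _
    (g_sigma_algebraType
      (\bigcup_i preimage_set_system setT (Xs i) measurable)) R
    setT (f n)) ->
  forall n (B : set R), measurable B ->
  P (N @^-1` [set n] `&` f n @^-1` B) =
  P (N @^-1` [set n]) * P (f n @^-1` B).
Proof.
move=> N_indep mf n B mB; apply: N_indep => //.
by rewrite -[_ @^-1` _]setTI; exact: (mf n measurableT B mB).
Qed.

Definition partial_sum (T : Type) (R : pzRingType) (X : nat -> T -> R) (n : nat)
    : T -> R :=
  fun w => (\sum_(i < n) X i w)%R.

Lemma partial_sum0 (T : Type) (R : pzRingType) (X : nat -> T -> R) :
  partial_sum X 0 = cst 0%R.
Proof. by apply/funext => w; rewrite /partial_sum big_ord0. Qed.

Lemma partial_sumS (T : Type) (R : pzRingType) (X : nat -> T -> R) (n : nat) :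
  partial_sum X n.+1 = (partial_sum X n \+ X n)%R.
Proof. by apply/funext => w; rewrite /partial_sum big_ord_recr. Qed.

Lemma measurable_partial_sum (d : measure_display) (T : measurableType d)
    (R : realType) (X : nat -> T -> R) (n : nat) :
  (forall i, measurable_fun [set: T] (X i)) ->
  measurable_fun [set: T] (partial_sum X n).
Proof.
move=> mX; elim: n => [|n IHn]; first by rewrite partial_sum0.
by rewrite partial_sumS; exact: measurable_funD.
Qed.

Lemma partial_sum_indep (d : measure_display) (T : measurableType d)
    (R : realType) (P : probability T R) (Xs : nat -> {RV P >-> R})
    (N : {RV P >-> nat}) :
  independent_of_seq N Xs ->
  forall n (B : set R), measurable B ->
  P (N @^-1` [set n] `&` partial_sum Xs n @^-1` B) =
  P (N @^-1` [set n]) * P (partial_sum Xs n @^-1` B).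
Proof.
move=> N_indep; apply: (independent_of_seq_preimage N_indep) => n.
pose G := \bigcup_i preimage_set_system [set: T] (Xs i) measurable.
(* Measurability of sums is used on [T] equipped with the sigma-algebra generated by the claims;
   each [Xs i] is measurable there because its preimages are generators. *)
apply: (@measurable_partial_sum _ (g_sigma_algebraType G)) => i _ B mB.
by apply: sub_sigma_algebra; exists i => //; exists B.
Qed.

Lemma Lfun_partial_sum (d : measure_display) (T : measurableType d)
    (R : realType) (P : probability T R) (X : nat -> T -> R) (n : nat) (p : R) :
  (1 <= p)%R -> (forall i, X i \in Lfun P p%:E) ->
  partial_sum X n \in Lfun P p%:E.
Proof.
move=> p1 LX; elim: n => [|n IHn]; first by rewrite partial_sum0 Lfun_cst.
by rewrite partial_sumS rpredD.
Qed.

Lemma expectation_partial_sum (d : measure_display) (T : measurableType d)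
    (R : realType) (P : probability T R) (X : nat -> T -> R) (m : R) (n : nat) :
  (forall i, X i \in Lfun P 1) -> (forall i, 'E_P[X i] = m%:E) ->
  'E_P[partial_sum X n] = (n%:R * m)%:E.
Proof.
move=> LX EX; elim: n => [|n IHn].
  by rewrite partial_sum0 expectation_cst mul0r.
rewrite partial_sumS expectationD//; last exact: Lfun_partial_sum.
by rewrite IHn EX -EFinD -natr1 mulrDl mul1r.
Qed.

(** The covariances are prescribed only for [i < n] so that [Z] may be [X n] itself, as the variance
    recursion requires. *)
Lemma covariance_partial_suml (d : measure_display) (T : measurableType d)
    (R : realType) (P : probability T R) (X : nat -> T -> R) (Z : T -> R)
    (c : R) (n : nat) :
  (forall i, X i \in Lfun P 2%:E) -> Z \in Lfun P 2%:E ->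
  (forall i, (i < n)%N -> covariance P (X i) Z = c%:E) ->
  covariance P (partial_sum X n) Z = (n%:R * c)%:E.
Proof.
move=> LX LZ; elim: n => [|n IHn] covX.
  by rewrite partial_sum0 covariance_cst_l mul0r.
rewrite partial_sumS covarianceDl//; last first.
  by apply: Lfun_partial_sum => //; rewrite ler1n.
rewrite IHn => [|i ltin]; last by rewrite covX// ltnW.
by rewrite covX// -EFinD -natr1 mulrDl mul1r.
Qed.

(** Adding [X n] contributes its variance [v] and twice its covariance [n * c] with the earlier sum,
    and [n (n - 1) + 2 n = (n + 1) n]. *)
Lemma variance_partial_sum (d : measure_display) (T : measurableType d)
    (R : realType) (P : probability T R) (X : nat -> T -> R) (v c : R)
    (n : nat) :
  (forall i, X i \in Lfun P 2%:E) -> (forall i, 'V_P[X i] = v%:E) ->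
  (forall i j, i <> j -> covariance P (X i) (X j) = c%:E) ->
  'V_P[partial_sum X n] = (n%:R * v + n%:R * (n%:R - 1) * c)%:E.
Proof.
move=> LX VX covX; elim: n => [|n IHn].
  by rewrite partial_sum0 variance_cst !mul0r addr0.
rewrite partial_sumS varianceD//; last first.
  by apply: Lfun_partial_sum => //; rewrite ler1n.
rewrite IHn VX (@covariance_partial_suml _ _ _ _ _ _ c)//; last first.
  by move=> i ltin; apply: covX => ein; rewrite ein ltnn in ltin.
rewrite -EFinM -!EFinD; congr EFin; rewrite -natr1; ring.
Qed.

(** Variance plus squared mean, grouped by powers of [n] so that averaging over [N] involves only
    its first two moments. *)
Lemma expectation_sqr_partial_sum (d : measure_display) (T : measurableType d)
    (R : realType) (P : probability T R) (X : nat -> T -> R) (m v c : R)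
    (n : nat) :
  (forall i, X i \in Lfun P 2%:E) -> (forall i, 'E_P[X i] = m%:E) ->
  (forall i, 'V_P[X i] = v%:E) ->
  (forall i j, i <> j -> covariance P (X i) (X j) = c%:E) ->
  'E_P[partial_sum X n ^+ 2] =
  (n%:R * (v - c) + n%:R ^+ 2 * (c + m ^+ 2))%:E.
Proof.
move=> LX EX VX covX.
have Pfin : P setT \is a fin_num := fin_num_measure P _ measurableT.
have LS : partial_sum X n \in Lfun P 2%:E.
  by apply: Lfun_partial_sum => //; rewrite ler1n.
have ES : 'E_P[partial_sum X n] = (n%:R * m)%:E.
  by apply: expectation_partial_sum => // i; exact: Lfun_subset12.
rewrite -['E_P[_]](@subeK _ _ ('E_P[partial_sum X n] ^+ 2)); last first.
  by rewrite ES -EFin_expe.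
rewrite -varianceE// (variance_partial_sum n LX VX covX) ES -EFin_expe -EFinD.
by congr EFin; ring.
Qed.

(** * Quantities determined by the law of a random variable *)

Lemma integral_identically_distributed (d : measure_display)
    (T : measurableType d) (R : realType) (P : probability T R)
    (Y Z : {RV P >-> R}) (g : R -> \bar R) :
  identically_distributed Y Z -> measurable_fun [set: R] g ->
  (forall y, 0 <= g y) -> \int[P]_w g (Y w) = \int[P]_w g (Z w).
Proof.
move=> YZ mg g0.
rewrite -(ge0_integral_distribution Y mg g0).
rewrite -(ge0_integral_distribution Z mg g0).
by apply: eq_measure_integral => B mB _; exact: YZ.
Qed.

Lemma Lfun_identically_distributed (d : measure_display)
    (T : measurableType d) (R : realType) (P : probability T R)
    (Y Z : {RV P >-> R}) (p : R) :
  identically_distributed Y Z ->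
  (Z : T -> R) \in Lfun P p%:E -> (Y : T -> R) \in Lfun P p%:E.
Proof.
move=> YZ; rewrite !inE => /andP[_]; rewrite inE/= => LZ; apply/andP; split.
  by rewrite inE/=.
rewrite inE/=; move: LZ; rewrite /finite_norm unlock.
rewrite (integral_identically_distributed (g := fun y => (`|y| `^ p)%:E) YZ)//.
exact/measurable_EFinP/(@measurableT_comp _ _ _ _ _ _ (@powR R ^~ p)).
Qed.

Lemma expectation_identically_distributed (d : measure_display)
    (T : measurableType d) (R : realType) (P : probability T R)
    (Y Z : {RV P >-> R}) :
  identically_distributed Y Z -> (Z : T -> R) \in Lfun P 1 ->
  'E_P[Y] = 'E_P[Z].
Proof.
move=> YZ LZ; have LY := Lfun_identically_distributed YZ LZ.
move/Lfun1_integrable : LZ => LZ; move/Lfun1_integrable : LY => LY.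
rewrite unlock -!(integral_distribution (f := EFin)) => //.
by apply: eq_measure_integral => B mB _; exact: YZ.
Qed.

(** Once the means agree, both variances integrate the same nonnegative function of the value, the
    squared distance to the common mean [m]. *)
Lemma variance_identically_distributed (d : measure_display)
    (T : measurableType d) (R : realType) (P : probability T R)
    (Y Z : {RV P >-> R}) :
  identically_distributed Y Z -> (Z : T -> R) \in Lfun P 1 ->
  'V_P[Y] = 'V_P[Z].
Proof.
move=> YZ LZ; rewrite /variance unlock.
rewrite (expectation_identically_distributed YZ LZ).
rewrite [in LHS]unlock [in RHS]unlock.
set m := fine _.
rewrite (integral_identically_distributed
  (g := fun y => ((y - m) * (y - m))%:E) YZ)//.
- by apply/measurable_EFinP; apply: measurable_funM; exact: measurable_funB.
- by move=> y; rewrite lee_fin -expr2 sqr_ge0.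
Qed.

Lemma Lfun2_of_expectation_sqr (d : measure_display) (T : measurableType d)
    (R : realType) (P : probability T R) (f : T -> R) :
  measurable_fun [set: T] f -> 'E_P[f ^+ 2] < +oo -> f \in Lfun P 2%:E.
Proof.
move=> mf; rewrite unlock => foo.
rewrite inE; apply/andP; split; rewrite inE//= /finite_norm unlock.
apply: poweR_lty; apply: le_lt_trans foo; rewrite le_eqVlt; apply/orP; left.
apply/eqP/eq_integral => w _.
by rewrite /= powR_mulrn// real_normK ?num_real.
Qed.

(** Square integrability enters only with the variance formula. The equality of all covariances of
    distinct claims makes explicit what a single term cov(X_i, X_j) presupposes. *)
Theorem lemma3 (d : measure_display) (T : measurableType d) (R : realType)
    (P : probability T R)
    (X : {RV P >-> R}) (Xs : nat -> {RV P >-> R}) (N : {RV P >-> nat})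
    (X_same_law : forall i : nat, identically_distributed (Xs i) X)
    (N_indep : independent_of_seq N Xs)
    (X_mean : (X : T -> R) \in Lfun P 1)
    (N_mean : claim_count N \in Lfun P 1) :
  'E_P[aggregate_claims N Xs] = 'E_P[claim_count N] * 'E_P[X] /\
  ((X : T -> R) \in Lfun P 2%:E ->
   claim_count N \in Lfun P 2%:E ->
   (forall i j k l : nat, i <> j -> k <> l ->
      covariance P (Xs i) (Xs j) = covariance P (Xs k) (Xs l)) ->
   forall i j : nat, i <> j ->
   'V_P[aggregate_claims N Xs] =
     'E_P[claim_count N] * 'V_P[X]
     + 'V_P[claim_count N] * ('E_P[X] ^+ 2)
     + 'E_P[fun w => (claim_count N w * (claim_count N w - 1))%R]
       * covariance P (Xs i) (Xs j)).
Proof.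
have Pfin : P setT \is a fin_num := fin_num_measure P _ measurableT.
set K := claim_count N.
have mS n : measurable_fun [set: T] (partial_sum Xs n).
  by apply: measurable_partial_sum => i; exact: measurable_funPT.
have indepS := partial_sum_indep N_indep.
have LXs i : (Xs i : T -> R) \in Lfun P 1.
  exact: Lfun_identically_distributed X_mean.
have Efin := expectation_fin_num X_mean.
have EXs i : 'E_P[Xs i] = (fine 'E_P[X])%:E.
  by rewrite fineK// (expectation_identically_distributed (X_same_law i)).
have ESn n := expectation_partial_sum n LXs EXs.
have ESK (m : R) : \int[P]_w ((N w)%:R * m)%:E = 'E_P[K] * m%:E.
  by rewrite muleC -expectationZl// unlock.
(* The absolute value of S_n is at most the sum of the absolute claims, whose mean is [n * a] with
   [a] the mean of the absolute value of [X]; averaging over [N] gives E(N) [a], which is finite. *)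
have abs_fin : \int[P]_w 'E_P[fun v => `|partial_sum Xs (N w) v|%R] < +oo.
  pose a := fine 'E_P[fun v => `|X v|%R].
  have LabsX : (fun v => `|X v|%R) \in Lfun P 1 by exact: Lfun_norm.
  have Eabs i : 'E_P[fun v => `|Xs i v|%R] = a%:E.
    rewrite fineK ?expectation_fin_num// unlock.
    apply: (integral_identically_distributed (g := fun y => `|y|%:E)) => //.
    by apply/measurable_EFinP; exact: normr_measurable.
  apply: (@le_lt_trans _ _ (\int[P]_w ((N w)%:R * a)%:E)); last first.
    by rewrite ESK ltey_eq fin_numM// expectation_fin_num.
  have mabs n : measurable_fun [set: T] (fun v => `|partial_sum Xs n v|%R).
    exact: measurableT_comp.
  apply: ge0_le_integral => //.
  - by move=> w _; exact: expectation_ge0.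
  - exact: (measurableT_comp
      (f := fun n => 'E_P[fun v => `|partial_sum Xs n v|%R])).
  - exact: (measurableT_comp (f := fun n => (n%:R * a)%:E)).
  move=> w _.
  rewrite -(@expectation_partial_sum _ _ _ P (fun i v => `|Xs i v|%R))//;
    last by move=> i; exact: Lfun_norm.
  apply: expectation_le => //.
  - by apply: measurable_partial_sum => i; exact: measurableT_comp.
  - by move=> v; exact: sumr_ge0.
  - by apply: aeW => v; exact: ler_norm_sum.
have ES := expectation_random_index mS indepS abs_fin.
rewrite -[fun w => partial_sum Xs (N w) w]/(aggregate_claims N Xs) in ES.
have {}ES : 'E_P[aggregate_claims N Xs] = 'E_P[K] * 'E_P[X].
  by rewrite ES; under eq_integral do rewrite ESn; rewrite ESK fineK.
split=> // X2 K2 cov_eq i j neq_ij.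
have LXs2 k : (Xs k : T -> R) \in Lfun P 2%:E.
  exact: Lfun_identically_distributed X2.
have VXs k : 'V_P[Xs k] = (fine 'V_P[X])%:E.
  rewrite fineK ?variance_fin_num//.
  exact: variance_identically_distributed.
have cfin : covariance P (Xs i) (Xs j) \is a fin_num.
  by apply: covariance_fin_num => //; exact: Lfun2_mul_Lfun1.
have covXs k l : k <> l ->
    covariance P (Xs k) (Xs l) = (fine (covariance P (Xs i) (Xs j)))%:E.
  by move=> neq_kl; rewrite fineK//; exact: cov_eq.
have ESn2 n := expectation_sqr_partial_sum n LXs2 EXs VXs covXs.
rewrite -(fineK Efin) in ES *.
rewrite -(fineK cfin) -(fineK (variance_fin_num X2)).
(* All moments of the claims are finite; they become real variables so that the final identity can
   be settled by [ring]. *)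
move: (fine 'E_P[X]) (fine 'V_P[X]) (fine (covariance _ _ _)) ES ESn2.
move=> m v c ES ESn2.
have K2K : (K ^+ 2)%R \in Lfun P 1 by exact: Lfun2_mul_Lfun1.
(* Squares are nonnegative, so conditioning on [N] is available before S_N is known to be square
   integrable; that follows from the finite value obtained here. *)
have ES2 : 'E_P[aggregate_claims N Xs ^+ 2] =
    (v - c)%:E * 'E_P[K] + (c + m ^+ 2)%:E * 'E_P[K ^+ 2].
  rewrite -!expectationZl// -expectationD ?Lfun_scale//.
  rewrite [in LHS]unlock.
  rewrite (ge0_integral_random_index (g := fun y => (y ^+ 2)%:E) mS indepS)//.
  - rewrite unlock; apply: eq_integral => w _.
    by have := ESn2 (N w); rewrite unlock => ->.
  - by apply/measurable_EFinP; exact: measurable_funX.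
  - by move=> y; rewrite lee_fin sqr_ge0.
have LS2 : aggregate_claims N Xs \in Lfun P 2%:E.
  apply: Lfun2_of_expectation_sqr; first exact: (measurable_random_index N mS).
  by rewrite ES2 ltey_eq fin_numD !fin_numM// expectation_fin_num.
have -> : 'E_P[fun w => (K w * (K w - 1))%R] = 'E_P[K ^+ 2] - 'E_P[K].
  rewrite -expectationB//; congr expectation; apply/funext => w /=.
  by rewrite mulrBr mulr1.
rewrite !varianceE// ES2 ES.
rewrite -(fineK (expectation_fin_num N_mean)) -(fineK (expectation_fin_num K2K)).
move: (fine _) (fine _) => n2 n1.
(* Both sides equal [(v - c)] E(N) + [(c + m ^+ 2)] E(N^2) - [m ^+ 2] E(N)^2. *)
rewrite -!EFinM -!EFin_expe -!EFinB -!EFinD; congr EFin; ring.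
Qed.
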